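(* Let $\mathcal M=(M,d,\mu)$ be a metric probability space. If $\mathcal M$ is regular and expands uniformly, then $\mathcal M$ admits thresholds.
   Context: For a metric probability space $\mathcal M=(M,d,\mu)$, a configuration $\mathbf x=(x_1,\dots,x_n)\in M^n$ and a radius $r\ge0$, let $G_{\mathcal M}(\mathbf x,r)$ be the graph on $[n]=\{1,\dots,n\}$ in which $i\ne j$ are adjacent iff $d(x_i,x_j)\le r$. The random geometric graph $G_{\mathcal M}(n,r)$ is $G_{\mathcal M}(\mathbf x,r)$ with $\mathbf x$ sampled from $\mu^n$. A monotone graph property $\mathcal F$ on $[n]$ is any family of graphs on the vertex set $[n]$ closed under adding edges (it need not be invariant under relabelling vertices); it is nontrivial if it is neither empty nor the family of all graphs on $[n]$. Write $\mathcal F_M(r)=\{\mathbf x\in M^n: G_{\mathcal M}(\mathbf x,r)\in\mathcal F\}$, so $\mathbb P(G_{\mathcal M}(n,r)\in\mathcal F)=\mu^n(\mathcal F_M(r))$. A sequence of radii $r_n>0$ is a threshold for a sequence $(\mathcal F_n)$ of nontrivial monotone properties ($\mathcal F_n$ on $[n]$) if $\mathbb P(G_{\mathcal M}(n,s_n)\in\mathcal F_n)\to0$ whenever $s_n/r_n\to0$ and $\to1$ whenever $s_n/r_n\to\infty$. $\mathcal M$ admits thresholds if every sequence of nontrivial monotone properties has a threshold. $\mathcal M$ is regular if for every $n\ge1$ and every nontrivial monotone property $\mathcal F$ on $[n]$, the function $r\mapsto\mu^n(\mathcal F_M(r))$ is continuous, equals $0$ at $r=0$, and equals $1$ for all sufficiently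 large $r$. For $K\ge0$ and $0<\rho\le1$, $\mathcal M$ has $(K,\rho)$-expansion if there is a finitely supported probability measure $\mathsf P$ on measure-preserving bijections $\phi:M\to M$ such that (E1) every $\phi$ in the support of $\mathsf P$ satisfies $\mathrm{Lip}(\phi)\le K$ and $\mathrm{Lip}(\phi^{-1})\le K$; and (E2) for every $n\ge1$ the operator $T_{\mathsf P}f(x_1,\dots,x_n)=\mathbb E_{\phi\sim\mathsf P}[f(\phi(x_1),\dots,\phi(x_n))]$ satisfies $\|T_{\mathsf P}f\|_2\le(1-\rho)\|f\|_2$ for all mean-zero $f\in L^2(M^n,\mu^n)$ (complex-valued). $\mathcal M$ expands uniformly if it has $(K,\rho)$-expansion for some finite $K$ and some $\rho>0$ (independent of $n$). *)

(* Defs.v *)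
From HB Require Import structures.
From mathcomp Require Import all_boot all_order all_algebra.
From mathcomp Require Import complex.
From mathcomp Require Import all_classical all_reals all_analysis.

Set Implicit Arguments.
Unset Strict Implicit.
Unset Printing Implicit Defensive.

Import Order.TTheory GRing.Theory Num.Theory.
Import numFieldNormedType.Exports.

Local Open Scope classical_set_scope.
Local Open Scope ring_scope.

(* Product probability mu^n on n.-tuple T, whose library sigma-algebra is the
   one generated by the coordinates. *)
Section power_measure.
Context {d : measure_display} {T : measurableType d} {R : realType}.

Definition tuple_cons (n : nat) (p : T * n.-tuple T) : n.+1.-tuple T :=
  [tuple of p.1 :: p.2].

Lemma measurable_tuple_cons (n : nat) :
  measurable_fun [set: T * n.-tuple T] (@tuple_cons n).
Proof. exact: measurable_cons. Qed.

HB.instance Definition _ (n : nat) :=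
  isMeasurableFun.Build _ _ _ _ (@tuple_cons n) (@measurable_tuple_cons n).

Variable mu : probability T R.

Fixpoint power_measure (n : nat) : probability (n.-tuple T) R :=
  match n with
  | 0 => \d_[tuple]
  | n'.+1 => distribution (mu \x power_measure n')%E (@tuple_cons n')
  end.

Lemma power_measure_box (n : nat) (A : 'I_n -> set T) :
  (forall i, measurable (A i)) ->
  power_measure n [set x | forall i, A i (tnth x i)] =
  (\prod_(i < n) mu (A i))%E.
Proof.
elim: n A => [|n IHn] A mA.
  rewrite big_ord0 /= diracE mem_set//.
  by case.
rewrite big_ord_recl -IHn//=.
rewrite -product_measure1E//.
  rewrite /distribution /pushforward; congr (product_measure1 _ _ _).
  apply/seteqP; split => -[a t] /=.
    move=> H; split; first by have := H ord0; rewrite tnth0.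
    by move=> i; have := H (lift ord0 i); rewrite tnthS.
  move=> [Ha Ht] i; case: (unliftP ord0 i) => [j ->|->].
    by rewrite tnthS.
  by rewrite tnth0.
rewrite [X in measurable X](_ : _ =
  \bigcap_(i in [set: 'I_n]) (@tnth n T ^~ i @^-1` A (lift ord0 i))).
  apply: fin_bigcap_measurable => // i _.
  by rewrite -[X in measurable X]setTI; exact: measurable_tnth.
by apply/seteqP; split => t /= H i; [move=> _|]; exact: H.
Qed.

End power_measure.

(* Every carrier of a probability measure is nonempty; the base point is only
   there because measurable types are pointed in the library. *)
#[short(type="pointedMetricType")]
HB.structure Definition PointedMetric (R : numDomainType) :=
  {M of Pointed M & Metric R M}.

Notation borel M := (g_sigma_algebraType (@open M)).

(* Joint measurability of the distance for the product sigma-algebra holds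
   automatically when M is separable. It is exactly what makes all the events
   {x | G_M(x, r) in F} measurable: for n = 2 and F = "1 and 2 are adjacent"
   these events are the sets {d <= r}. *)
Record metricProbSpace (R : realType) := MetricProbSpace {
  mps_space :> pointedMetricType R ;
  mps_measure : probability (borel mps_space) R ;
  mps_dist_measurable :
    measurable_fun [set: borel mps_space * borel mps_space]
      (fun p => mdist (p.1 : mps_space) (p.2 : mps_space)) }.

Record sgraph (n : nat) := SGraph {
  adj :> 'I_n -> 'I_n -> bool ;
  adj_sym : symmetric adj ;
  adj_irr : irreflexive adj }.

Definition subgraph (n : nat) (G H : sgraph n) : Prop :=
  forall i j, G i j -> H i j.

Definition graph_property (n : nat) := set (sgraph n).

Definition monotone_property (n : nat) (F : graph_property n) : Prop :=
  forall G H, subgraph G H -> F G -> F H.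

Definition nontrivial_property (n : nat) (F : graph_property n) : Prop :=
  F <> set0 /\ F <> setT.

Section geometric_graphs.
Context {R : realType} (M : metricProbSpace R).

Section geom_graph.
Context {n : nat} (x : n.-tuple (borel M)) (r : R).

Definition geom_adj (i j : 'I_n) : bool :=
  (i != j) && (mdist (tnth x i : M) (tnth x j : M) <= r).

Lemma geom_adj_sym : symmetric geom_adj.
Proof. by move=> i j; rewrite /geom_adj eq_sym metric_sym. Qed.

Lemma geom_adj_irr : irreflexive geom_adj.
Proof. by move=> i; rewrite /geom_adj eqxx. Qed.

Definition geom_graph : sgraph n := SGraph geom_adj_sym geom_adj_irr.

End geom_graph.

Definition config_set (n : nat) (F : graph_property n) (r : R) :
    set (n.-tuple (borel M)) :=
  [set x | F (geom_graph x r)].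

Definition prob_rgg (n : nat) (F : graph_property n) (r : R) : \bar R :=
  power_measure (mps_measure M) n (config_set F r).

(* There is exactly one graph on [0] and on [1], hence no nontrivial property
   there: sequences of nontrivial properties start at n = 2. *)
Definition nontrivial_monotone_sequence (F : forall n, graph_property n) :
    Prop :=
  forall n, (2 <= n)%N -> nontrivial_property (F n) /\ monotone_property (F n).

Definition is_threshold (F : forall n, graph_property n) (r : nat -> R) :
    Prop :=
  [/\ forall n, 0 < r n,
      forall s : nat -> R, (forall n, 0 <= s n) ->
        s n / r n @[n --> \oo] --> (0 : R) ->
        prob_rgg (F n) (s n) @[n --> \oo] --> 0%E
    & forall s : nat -> R, (forall n, 0 <= s n) ->
        s n / r n @[n --> \oo] --> +oo ->
        prob_rgg (F n) (s n) @[n --> \oo] --> 1%E].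

Definition admits_thresholds : Prop :=
  forall F : forall n, graph_property n,
    nontrivial_monotone_sequence F -> exists r, is_threshold F r.

Definition regular : Prop :=
  forall (n : nat) (F : graph_property n), (1 <= n)%N ->
    nontrivial_property F -> monotone_property F ->
    [/\ {within `[0, +oo[%classic, continuous (prob_rgg F)},
        prob_rgg F 0 = 0%E
      & exists r0 : R, forall r, r0 <= r -> prob_rgg F r = 1%E].

Definition lipschitz_le (K : R) (phi : M -> M) : Prop :=
  forall x y, mdist (phi x) (phi y) <= K * mdist x y.

Definition measure_preserving (phi : M -> M) : Prop :=
  measurable_fun [set: borel M] (phi : borel M -> borel M) /\
  forall A : set (borel M), measurable A ->
    mps_measure M (phi @^-1` A) = mps_measure M A.

(* A finitely supported probability measure on the measure-preserving
   bijections, given by its mass function. *)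
Definition mass_support (P : (M -> M) -> R) : set (M -> M) :=
  [set phi | P phi != 0].

Definition finitely_supported_probability (P : (M -> M) -> R) : Prop :=
  [/\ finite_set (mass_support P),
      forall phi, 0 <= P phi,
      \sum_(phi \in mass_support P) P phi = 1
    & forall phi, mass_support P phi -> bijective phi /\ measure_preserving phi].

Definition averaging_op (P : (M -> M) -> R) (n : nat)
    (f : n.-tuple (borel M) -> R[i]) (x : n.-tuple (borel M)) : R[i] :=
  \sum_(phi \in mass_support P) real_complex R (P phi) * f (map_tuple phi x).

Definition L2norm (n : nat) (f : n.-tuple (borel M) -> R[i]) : \bar R :=
  Lnorm (power_measure (mps_measure M) n) 2%:E
    (fun x => (ComplexField.Normc.normc (f x))%:E).

Definition in_L2 (n : nat) (f : n.-tuple (borel M) -> R[i]) : Prop :=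
  [/\ measurable_fun setT (fun x => complex.Re (f x)),
      measurable_fun setT (fun x => complex.Im (f x))
    & (L2norm f < +oo)%E].

Definition mean_zero (n : nat) (f : n.-tuple (borel M) -> R[i]) : Prop :=
  (\int[power_measure (mps_measure M) n]_x (complex.Re (f x))%:E = 0)%E /\
  (\int[power_measure (mps_measure M) n]_x (complex.Im (f x))%:E = 0)%E.

Definition has_expansion (K rho : R) : Prop :=
  exists P : (M -> M) -> R,
  [/\ finitely_supported_probability P,
      (forall phi, mass_support P phi ->
        lipschitz_le K phi /\
        exists2 psi, cancel phi psi /\ cancel psi phi & lipschitz_le K psi)
    & forall n (f : n.-tuple (borel M) -> R[i]), (1 <= n)%N ->
        in_L2 f -> mean_zero f ->
        (L2norm (averaging_op P f) <= (1 - rho)%:E * L2norm f)%E].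

Definition expands_uniformly : Prop :=
  exists K rho : R, [/\ 0 <= K, 0 < rho <= 1 & has_expansion K rho].

End geometric_graphs.

(* Main.v *)
Require Import Defs.
From mathcomp Require Import all_boot all_order all_algebra.
From mathcomp Require Import complex.
From mathcomp Require Import ring lra.
From mathcomp Require Import all_classical all_reals all_analysis.
From mathcomp Require Import measurable_realfun.

(* Let A = F_M(r) have probability a and B = F_M(K r) probability b. Since the
   inverses of the maps phi in the support of P are K-Lipschitz and F is
   monotone, phi(x) in A forces x in B, so h = T_P 1_A vanishes off B.
   Cauchy-Schwarz gives a^2 <= b E h^2, while E h^2 - a^2 is the squared norm of
   T_P (1_A - a), hence at most q a (1 - a) with q = (1 - rho)^2. Therefore
   a (1 - b) <= q b (1 - a): multiplying the radius by K multiplies the odds by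
   at least 1 / q. Taking for r_n the radius of probability 1/2 given by
   regularity, K^k r_n has odds at least q^-k and K^-k r_n odds at most q^k. *)

Set Implicit Arguments.
Unset Strict Implicit.
Unset Printing Implicit Defensive.

Import Order.TTheory GRing.Theory Num.Theory.
Import numFieldNormedType.Exports.

Local Open Scope classical_set_scope.
Local Open Scope ring_scope.

(** * Integrals of bounded functions on a probability space *)

Section bounded_functions.
Context {d : measure_display} {T : measurableType d} {R : realType}.
Variable P : probability T R.

Lemma integrable_bounded (f : T -> R) (c : R) :
  measurable_fun setT f -> (forall x, `|f x| <= c) ->
  P.-integrable setT (EFin \o f).
Proof.
move=> mf fc; apply: measurable_bounded_integrable => //.
  by apply: (le_lt_trans (probability_le1 P measurableT)); exact: ltry.
exists c; split; first exact: num_real.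
by move=> y cy x _; exact: le_trans (fc x) (ltW cy).
Qed.

Lemma Rintegral_indic (A : set T) : measurable A ->
  \int[P]_x \1_A x = fine (P A).
Proof. by move=> mA; rewrite /Rintegral integral_indic// setIT. Qed.

Lemma Rintegral_cst_probability (c : R) : \int[P]_x cst c x = c.
Proof.
rewrite Rintegral_cst//; transitivity (c * fine (P setT)); first by [].
by rewrite probability_setT mulr1.
Qed.

(** The variance of a Bernoulli variable: since [\1_A] takes only the values 0 and 1, its centred
    square is affine in [\1_A]. *)
Lemma Rintegral_indic_center_sqr (A : set T) : measurable A ->
  \int[P]_x (\1_A x - fine (P A)) ^+ 2 = fine (P A) - fine (P A) ^+ 2.
Proof.
move=> mA; set a := fine (P A).
rewrite (@eq_Rintegral _ _ _ P setT
    (fun x => (1 - 2 * a) * \1_A x + cst (a ^+ 2) x)); last first.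
  move=> x _ /=; rewrite indicE.
  by case: (_ \in _); rewrite ?mulr1n ?mulr0n; ring.
have iA : P.-integrable setT (EFin \o (\1_A : T -> R)) by exact: integrable_indic.
rewrite RintegralD//; last 2 first.
- apply: (@integrable_bounded _ `|1 - 2 * a|).
    exact: measurable_funM.
  move=> x; rewrite normrM ler_piMr// indicE.
  by case: (_ \in _); rewrite ?normr1 ?normr0.
- exact: finite_measure_integrable_cst.
rewrite RintegralZl// Rintegral_indic// Rintegral_cst_probability.
by rewrite -/a; ring.
Qed.

(* Integrates the pointwise bound h^2 >= 2 c h - c^2 1_B. The choice c = a / P B
   turns it into the Cauchy-Schwarz inequality (E h)^2 <= P B * E h^2. *)
Lemma Rintegral_center_sqr_ge (B : set T) (h : T -> R) (a c : R) :
  measurable B -> measurable_fun setT h -> (forall x, 0 <= h x <= 1) ->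
  (forall x, ~ B x -> h x = 0) -> \int[P]_x h x = a ->
  2 * c * a - c ^+ 2 * fine (P B) - a ^+ 2 <= \int[P]_x (h x - a) ^+ 2.
Proof.
move=> mB mh h01 hB ha.
have hbd x : `|h x| <= 1.
  by have /andP[h0 h1] := h01 x; rewrite ger0_norm.
have ih : P.-integrable setT (EFin \o h) by exact: integrable_bounded hbd.
have i1 : P.-integrable setT (EFin \o (fun x => 2 * (c - a) * h x)).
  apply: (@integrable_bounded _ `|2 * (c - a)|); first exact: measurable_funM.
  by move=> x; rewrite normrM ler_piMr.
have i2 : P.-integrable setT (EFin \o (fun x => - c ^+ 2 * \1_B x)).
  apply: (@integrable_bounded _ `|- c ^+ 2|); first exact: measurable_funM.
  move=> x; rewrite normrM ler_piMr// indicE.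
  by case: (_ \in _); rewrite ?normr1 ?normr0.
have i12 : P.-integrable setT
    (EFin \o (fun x => 2 * (c - a) * h x + - c ^+ 2 * \1_B x)).
  exact: (integrableD measurableT i1 i2).
have i3 : P.-integrable setT (EFin \o cst (a ^+ 2)).
  exact: finite_measure_integrable_cst.
apply: (@le_trans _ _
  (\int[P]_x (2 * (c - a) * h x + - c ^+ 2 * \1_B x + cst (a ^+ 2) x))).
  rewrite RintegralD// RintegralD// RintegralZl// RintegralZl//; last first.
    exact: integrable_indic.
  rewrite ha Rintegral_indic// Rintegral_cst_probability; lra.
apply: le_Rintegral => //.
- exact: (integrableD measurableT i12 i3).
- apply: (@integrable_bounded _ ((1 + `|a|) ^+ 2)).
    by apply: measurable_funX; exact: measurable_funB.
  move=> x; rewrite normrX lerXn2r ?nnegrE// ?addr_ge0//.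
  by rewrite (le_trans (ler_normB _ _))// lerD2r.
- move=> x _ /=; rewrite indicE; have [xB|xB] := pselect (B x).
    rewrite mem_set//= mulr1n.
    by have := sqr_ge0 (h x - c); nra.
  by rewrite memNset//= hB// mulr0n; lra.
Qed.

End bounded_functions.

(** * Invariance of the power measure under a map acting on every coordinate *)

Section power_measure_invariance.
Context {d : measure_display} {T : measurableType d} {R : realType}.
Variable mu : probability T R.
Variable phi : T -> T.
Hypothesis mphi : measurable_fun setT phi.
Hypothesis phi_mu : forall A, measurable A -> mu (phi @^-1` A) = mu A.

Lemma measurable_map_tuple (n : nat) :
  measurable_fun setT (@map_tuple n T T phi).
Proof.
apply/measurable_fun_tnthP => i.
rewrite (_ : _ \o _ = phi \o (@tnth n T)^~ i); last first.
  by apply/funext => x /=; rewrite tnth_map.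
by apply: measurableT_comp => //; exact: measurable_tnth.
Qed.

(** Induction through Fubini: the product measure integrates the measures of sections, the induction
    hypothesis removes [phi] from the tail, and a change of variables removes it from the first
    coordinate. *)
Lemma power_measure_map_tuple (n : nat) (A : set (n.-tuple T)) :
  measurable A -> power_measure mu n (map_tuple phi @^-1` A) =
                  power_measure mu n A.
Proof.
elim: n A => [|n IHn] A mA.
  rewrite /= !diracE; congr (_%:R%:E); congr nat_of_bool.
  by apply/idP/idP; rewrite !inE/= (_ : map_tuple _ _ = [tuple])//; exact: tuple0.
pose C := @tuple_cons d T n @^-1` A.
have mC : measurable C.
  by rewrite -[C]setTI; exact: measurable_tuple_cons.
rewrite /= /distribution /pushforward /=.
rewrite (_ : @tuple_cons d T n @^-1` (map_tuple phi @^-1` A) =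
   [set p | C (phi p.1, map_tuple phi p.2)]); last first.
  apply/seteqP; split => -[t x] /=; rewrite /C /= => H.
    by rewrite (_ : tuple_cons _ = map_tuple phi (tuple_cons (t, x)))//; exact: val_inj.
  by rewrite (_ : map_tuple phi _ = tuple_cons (phi t, map_tuple phi x))//; exact: val_inj.
rewrite /product_measure1.
transitivity (\int[mu]_x ((power_measure mu n \o xsection C) \o phi) x)%E.
  apply: eq_integral => t _ /=.
  have mS : measurable (xsection C (phi t)) by exact: measurable_xsection.
  by rewrite -(IHn _ mS).
have mx := measurable_fun_xsection (power_measure mu n) mC.
rewrite -[LHS](@ge0_integral_pushforward _ _ _ _ _ _ mphi mu setT)//.
by apply: eq_measure_integral => B mB _; exact: phi_mu.
Qed.

End power_measure_invariance.

(** For [b > 0] the quadratic in [c] is maximal at [c = a / b], with value [a ^+ 2 * (1 - b) / b].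
    Multiplying by [b] and cancelling one [a] gives the claim, so vanishing [b] or [a] is treated
    first. *)
Lemma odds_le_of_quadratic (R : realFieldType) (a b q : R) :
  0 <= a -> a <= b -> 0 <= q ->
  (forall c, 2 * c * a - c ^+ 2 * b - a ^+ 2 <= q * (a - a ^+ 2)) ->
  a * (1 - b) <= q * (b * (1 - a)).
Proof.
move=> a0 ab q0 key; have [b_le0|b_gt0] := leP b 0.
  have a_eq0 : a = 0 by lra.
  have b_eq0 : b = 0 by lra.
  by rewrite a_eq0 b_eq0 !mul0r mulr0.
have [a_le0|a_gt0] := leP a 0.
  have -> : a = 0 by lra.
  by rewrite mul0r mulr_ge0// subr0 mulr1 ltW.
rewrite -(ler_pM2l a_gt0).
have := ler_wpM2r (ltW b_gt0) (key (a / b)).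
rewrite (_ : (2 * (a / b) * a - (a / b) ^+ 2 * b - a ^+ 2) * b =
  a * (a * (1 - b))); first by move=> /le_trans; apply; lra.
by field; rewrite gt_eqF.
Qed.

(** * Events of a graph property: measurability, monotonicity and images under Lipschitz maps *)

Lemma sgraph_ext (n : nat) (G H : sgraph n) : G =2 H -> G = H.
Proof.
case: G => a sa ia; case: H => b sb ib /= ab.
have {}ab : a = b by apply/funext => i; apply/funext => j; exact: ab.
by subst b; congr SGraph; exact: Prop_irrelevance.
Qed.

Section configurations.
Context {R : realType} (M : metricProbSpace R).

Lemma measurable_geom_adj (n : nat) (r : R) (i j : 'I_n) (b : bool) :
  measurable [set x : n.-tuple (borel M) | geom_adj x r i j = b].
Proof.
have mf : measurable_fun setT (fun x : n.-tuple (borel M) => geom_adj x r i j).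
  apply: measurable_and; first exact: measurable_cst.
  apply: measurable_fun_ler => //.
  have mij : measurable_fun setT
      (fun x : n.-tuple (borel M) => (tnth x i, tnth x j)).
    by apply: measurable_fun_pair; exact: measurable_tnth.
  exact: (measurableT_comp (@mps_dist_measurable R M) mij).
by rewrite -[X in measurable X]setTI; exact: (mf measurableT [set b]).
Qed.

(** The family [F] is arbitrary, but there are only finitely many adjacency matrices [e]: the event
    is a finite union, over the matrices of graphs in [F], of the finite intersections [S e]. *)
Lemma measurable_config_set (n : nat) (F : graph_property n) (r : R) :
  measurable (config_set (M := M) F r).
Proof.
pose S (e : {ffun 'I_n * 'I_n -> bool}) := \bigcap_(p in [set: 'I_n * 'I_n])
  [set x : n.-tuple (borel M) | geom_adj x r p.1 p.2 = e p].
have -> : config_set (M := M) F r =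
    \bigcup_(e in [set e : {ffun _ -> bool} |
      exists2 G, F G & forall i j, G i j = e (i, j)]) S e.
  apply/seteqP; split => x /=.
    move=> Fx; exists [ffun p => geom_adj x r p.1 p.2] => /=.
      by exists (geom_graph x r) => // i j; rewrite ffunE.
    by move=> p _; rewrite /= ffunE.
  move=> [e /= [G FG Ge] Se]; rewrite /config_set /= (_ : geom_graph x r = G)//.
  by apply: sgraph_ext => i j; rewrite Ge; exact: (Se (i, j)).
apply: fin_bigcup_measurable; first exact: finite_finset.
move=> e _; apply: fin_bigcap_measurable; first exact: finite_finset.
by move=> p _; exact: measurable_geom_adj.
Qed.

Lemma config_set_le (n : nat) (F : graph_property n) (r s : R) :
  monotone_property F -> r <= s ->
  config_set (M := M) F r `<=` config_set F s.
Proof.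
move=> mF rs x; apply: mF => i j /andP[ij xr].
by apply/andP; split => //; exact: le_trans rs.
Qed.

Lemma config_set_map_tuple (n : nat) (F : graph_property n) (K r : R)
    (phi : M -> M) (x : n.-tuple (borel M)) :
  monotone_property F -> 0 <= K -> lipschitz_le K phi ->
  config_set F r x -> config_set F (K * r) (map_tuple phi x).
Proof.
move=> mF K0 lip; apply: mF => i j /andP[ij xr].
apply/andP; split => //; rewrite !tnth_map.
by rewrite (le_trans (lip _ _))// ler_wpM2l.
Qed.

Lemma prob_rgg_fin_num (n : nat) (F : graph_property n) (r : R) :
  prob_rgg M F r \is a fin_num.
Proof. by apply: fin_num_measure; exact: measurable_config_set. Qed.

Lemma fine_prob_rgg_ge0 (n : nat) (F : graph_property n) (r : R) :
  0 <= fine (prob_rgg M F r).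
Proof. by rewrite fine_ge0// measure_ge0. Qed.

Lemma fine_prob_rgg_le1 (n : nat) (F : graph_property n) (r : R) :
  fine (prob_rgg M F r) <= 1.
Proof.
rewrite -lee_fin fineK ?prob_rgg_fin_num//.
by apply: probability_le1; exact: measurable_config_set.
Qed.

Lemma le_fine_prob_rgg (n : nat) (F : graph_property n) (r s : R) :
  monotone_property F -> r <= s ->
  fine (prob_rgg M F r) <= fine (prob_rgg M F s).
Proof.
move=> mF rs; rewrite -lee_fin !fineK ?prob_rgg_fin_num//.
apply: le_measure; rewrite ?inE; try exact: measurable_config_set.
exact: config_set_le.
Qed.

(** Used to read the contraction estimate as an inequality between variances. Boundedness makes the
    integral finite, so passing to its real value loses nothing. *)
Lemma L2norm_real (n : nat) (g : n.-tuple (borel M) -> R) (c : R) :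
  measurable_fun setT g -> (forall x, `|g x| <= c) ->
  L2norm (fun x => real_complex R (g x)) =
  (Num.sqrt (\int[power_measure (mps_measure M) n]_x g x ^+ 2))%:E.
Proof.
move=> mg gc; rewrite /L2norm unlock /Lnorm.
under eq_integral => x _.
  rewrite /= expr0n/= addr0 sqrtr_sqr normr_id.
  rewrite (@powR_mulrn _ _ 2)// real_normK ?num_real//.
  over.
have ig : (power_measure (mps_measure M) n).-integrable setT
    (EFin \o (fun x => g x ^+ 2)).
  apply: (@integrable_bounded _ _ _ _ _ (c ^+ 2)); first exact: measurable_funX.
  move=> x; rewrite normrX lerXn2r ?nnegrE//.
  exact: le_trans (gc x).
rewrite -[X in (X `^ _)%E]fineK; last exact: integrable_fin_num.
rewrite poweR_EFin powR12_sqrt//.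
by apply: Rintegral_ge0 => x _; exact: sqr_ge0.
Qed.

(** Allows [K] to be taken at least 1, so that multiplying a radius by [K] never decreases it. *)
Lemma has_expansion_le (K K' rho : R) : K <= K' ->
  has_expansion M K rho -> has_expansion M K' rho.
Proof.
move=> KK' [P [Pp Pl PE]]; exists P; split => // phi /Pl[lphi [psi c lpsi]].
have lipW f : lipschitz_le (M := M) K f -> lipschitz_le K' f.
  move=> lf x y; rewrite (le_trans (lf x y))// ler_wpM2r//.
  exact: mdist_ge0.
by split; [exact: lipW | exists psi => //; exact: lipW].
Qed.

(** * Effect on the odds of multiplying the radius by [K] *)

Section expansion_step.
Variables (K rho : R) (P : (M -> M) -> R) (n : nat) (F : graph_property n).
Variable r : R.
Hypothesis K1 : 1 <= K.
Hypothesis r0 : 0 <= r.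
Hypothesis mF : monotone_property F.
Hypothesis P_prob : finitely_supported_probability P.
Hypothesis P_lip : forall phi, mass_support P phi -> lipschitz_le K phi /\
  exists2 psi, cancel phi psi /\ cancel psi phi & lipschitz_le K psi.

Let mun := power_measure (mps_measure M) n.
Let A := config_set (M := M) F r.
Let B := config_set (M := M) F (K * r).
Let a := fine (mun A).
Let s : seq (M -> M) := finmap.enum_fset (fset_set (mass_support P)).
Let h (x : n.-tuple (borel M)) : R :=
  \sum_(phi <- s) P phi * \1_A (map_tuple phi x).

Let s_support phi : phi \in s -> mass_support P phi.
Proof. by case: P_prob => fP _ _ _; rewrite in_fset_set// inE. Qed.

Let sum_s : \sum_(phi <- s) P phi = 1.
Proof. by case: P_prob => fP _ + _; rewrite fsbig_finite. Qed.

Let mA : measurable A. Proof. exact: measurable_config_set. Qed.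

(** Averaging fixes constants because the masses sum to 1, hence it commutes with centring. *)
Let averaging_op_indic x :
  averaging_op P (fun y => real_complex R (\1_A y - a)) x =
  real_complex R (h x - a).
Proof.
case: P_prob => fP _ _ _; rewrite /averaging_op fsbig_finite//= -/s.
under eq_bigr do rewrite -rmorphM mulrBr.
by rewrite -rmorph_sum/= sumrB -mulr_suml sum_s mul1r.
Qed.

(** Covers every [phi], as termwise measurability and integration of [h] require: off the support
    the mass is 0 and the term vanishes, on it [phi] is measurable. *)
Let term_measurable phi :
  measurable_fun setT
    (fun x : n.-tuple (borel M) => P phi * \1_A (map_tuple phi x) : R).
Proof.
have [->|Pphi] := eqVneq (P phi) 0.
  by under eq_fun do rewrite mul0r; exact: measurable_cst.
case: P_prob => _ _ _ /(_ _ Pphi)[_ [mphi _]].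
apply: measurable_funM; first exact: measurable_cst.
have mI : measurable_fun setT (\1_A : n.-tuple (borel M) -> R).
  exact: measurable_indic.
exact: (measurableT_comp mI (measurable_map_tuple (n := n) mphi)).
Qed.

Let term_ge0_le phi (x : n.-tuple (borel M)) : 0 <= P phi * \1_A (map_tuple phi x) <= P phi.
Proof.
case: P_prob => _ P0 _ _; rewrite indicE.
by case: (_ \in _); rewrite ?mulr1 ?mulr0 ?lexx ?P0.
Qed.

(** A map in the support moves [A] without changing its probability; this is what gives [h] the mean
    [a]. *)
Let term_integral phi :
  (\int[mun]_x (P phi * \1_A (map_tuple phi x : n.-tuple (borel M)))%:E =
   (P phi * a)%:E)%E.
Proof.
have [->|Pphi] := eqVneq (P phi) 0.
  by under eq_integral do rewrite mul0r; rewrite integral0 mul0r.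
case: P_prob => _ P0 _ /(_ _ Pphi)[_ [mphi phimu]].
have mpre : measurable (@map_tuple n (borel M) (borel M) phi @^-1` A).
  by rewrite -[X in measurable X]setTI; exact: measurable_map_tuple.
under eq_integral do rewrite EFinM.
rewrite ge0_integralZl_EFin//; last first.
  by apply/measurable_EFinP; exact: (@measurable_indic _ _ _ _ _ mpre).
rewrite (_ : (\int[mun]_x _)%E = mun A).
  by rewrite EFinM /a fineK// fin_num_measure.
rewrite -(power_measure_map_tuple mphi phimu mA).
by rewrite -[in RHS](setIT (_ @^-1` _)) -integral_indic.
Qed.

Let h_measurable : measurable_fun setT h.
Proof. by apply: measurable_sum => phi; exact: term_measurable. Qed.

Let h01 x : 0 <= h x <= 1.
Proof.
apply/andP; split.
  by apply: sumr_ge0 => phi _; have /andP[] := term_ge0_le phi x.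
by rewrite -sum_s; apply: ler_sum => phi _; have /andP[] := term_ge0_le phi x.
Qed.

Let h_eq0 x : ~ B x -> h x = 0.
Proof.
move=> Bx; rewrite /h big1_seq// => phi /andP[_ /s_support /P_lip].
move=> [_ [psi [phiK _] lpsi]]; rewrite indicE memNset ?mulr0// => Ax.
apply: Bx; have K0 : 0 <= K by exact: le_trans K1.
have := config_set_map_tuple mF K0 lpsi Ax.
rewrite (_ : map_tuple psi _ = x)//.
by apply/eq_from_tnth => i; rewrite !tnth_map phiK.
Qed.

Let h_integral : \int[mun]_x h x = a.
Proof.
rewrite /Rintegral /h; under eq_integral do rewrite -sumEFin.
rewrite integral_sum//; last first.
  move=> phi; apply: (@integrable_bounded _ _ _ _ _ (P phi)) => //.
  by move=> x; have /andP[? ?] := term_ge0_le phi x; rewrite ger0_norm.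
under eq_bigr do rewrite term_integral.
by rewrite sumEFin/= -mulr_suml sum_s mul1r.
Qed.

(** The contraction is assumed only for the centred indicator of [A]. Squared, it bounds the
    variance of [h] by [(1 - rho) ^+ 2] times that of [\1_A]; the lower bound on the variance of
    [h], valid for every [c], then yields the odds inequality. *)
Lemma odds_step :
  (L2norm (averaging_op P (fun y => real_complex R (\1_A y - a)))
    <= (1 - rho)%:E * L2norm (fun y => real_complex R (\1_A y - a)))%E ->
  rho <= 1 ->
  fine (prob_rgg M F r) * (1 - fine (prob_rgg M F (K * r))) <=
  (1 - rho) ^+ 2 *
    (fine (prob_rgg M F (K * r)) * (1 - fine (prob_rgg M F r))).
Proof.
move=> + rho1.
have -> : averaging_op P (fun y => real_complex R (\1_A y - a)) =
    (fun x => real_complex R (h x - a)).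
  by apply/funext => x; exact: averaging_op_indic.
have bnd (u : R) : 0 <= u <= 1 -> `|u - a| <= 1 + `|a|.
  move=> /andP[u0 u1]; rewrite (le_trans (ler_normB _ _))//.
  by rewrite lerD2r ger0_norm.
rewrite (@L2norm_real _ (fun x => h x - a) (1 + `|a|)); last 2 first.
- exact: measurable_funB.
- by move=> x; exact: bnd.
rewrite (@L2norm_real _ (fun x => \1_A x - a) (1 + `|a|)); last 2 first.
- exact: measurable_funB.
- by move=> x; apply: bnd; rewrite indicE; case: (_ \in _); rewrite ?lexx ?ler01.
rewrite -EFinM lee_fin Rintegral_indic_center_sqr// -/a => contr.
pose b := fine (mun B).
have key c : 2 * c * a - c ^+ 2 * b - a ^+ 2 <= (1 - rho) ^+ 2 * (a - a ^+ 2).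
  apply: (le_trans (Rintegral_center_sqr_ge c (measurable_config_set F (K * r))
    h_measurable h01 h_eq0 h_integral)).
  (* Both variances are written as squares of their roots, so that [contr] can be squared; they are
     nonnegative as integrals of squares. *)
  rewrite -[leLHS]sqr_sqrtr; last first.
    by apply: Rintegral_ge0 => x _; exact: sqr_ge0.
  rewrite (_ : a - a ^+ 2 = Num.sqrt (a - a ^+ 2) ^+ 2); last first.
    rewrite sqr_sqrtr// /a -Rintegral_indic_center_sqr//.
    by apply: Rintegral_ge0 => x _; exact: sqr_ge0.
  rewrite -exprMn lerXn2r ?nnegrE ?sqrtr_ge0// mulr_ge0 ?sqrtr_ge0//.
  by rewrite subr_ge0.
have a0 : 0 <= a by exact: fine_prob_rgg_ge0.
(* Here [1 <= K] and [0 <= r] give [r <= K * r]. *)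
have ab : a <= b by apply: le_fine_prob_rgg => //; rewrite ler_peMl.
exact: (odds_le_of_quadratic a0 ab (sqr_ge0 _) key).
Qed.

End expansion_step.

(** The centred indicator is an admissible test function: it is bounded, hence in L2, and has mean
    [a - a]. *)
Lemma has_expansion_odds (K rho : R) : 1 <= K -> rho <= 1 ->
  has_expansion M K rho ->
  forall (n : nat) (F : graph_property n) (r : R), (1 <= n)%N ->
    monotone_property F -> 0 <= r ->
  fine (prob_rgg M F r) * (1 - fine (prob_rgg M F (K * r))) <=
  (1 - rho) ^+ 2 *
    (fine (prob_rgg M F (K * r)) * (1 - fine (prob_rgg M F r))).
Proof.
move=> K1 rho1 [P [Pp Pl PE]] n F r n1 mF r0.
have mA := @measurable_config_set n F r.
set A := config_set F r in mA.
set a := fine (power_measure (mps_measure M) n A).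
have mf : measurable_fun setT
    (fun x : n.-tuple (borel M) => \1_A x - a : R).
  by apply: measurable_funB.
have fbd (x : n.-tuple (borel M)) : `|\1_A x - a| <= 1 + `|a|.
  rewrite (le_trans (ler_normB _ _))// lerD2r indicE.
  by case: (_ \in _); rewrite ?normr1 ?normr0.
apply: (odds_step K1 r0 mF Pp Pl) => //; apply: PE => //.
  split; [exact: mf | exact: measurable_cst |].
  by rewrite (L2norm_real mf fbd) ltry.
split => /=; last by rewrite integral0.
rewrite -[LHS]fineK; last first.
  by apply: integrable_fin_num => //; exact: integrable_bounded mf fbd.
congr EFin; rewrite -[LHS]/(Rintegral _ _ _).
rewrite RintegralB//; last exact: finite_measure_integrable_cst.
  rewrite Rintegral_indic// (Rintegral_cst_probability _ a) -/a.
  exact: subrr.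
exact: integrable_indic.
Qed.

End configurations.

(* The hypothesis, cleared of denominators, says that the odds p / (1 - p) grow
   by a factor at least 1 / q at each step. *)
Lemma odds_iter (R : realFieldType) (q : R) (p : nat -> R) :
  0 <= q -> (forall k, 0 <= p k <= 1) ->
  (forall k, p k * (1 - p k.+1) <= q * (p k.+1 * (1 - p k))) ->
  forall k, p 0 * (1 - p k) <= q ^+ k * (p k * (1 - p 0)).
Proof.
move=> q0 p01 step; elim=> [|k IHk]; first by rewrite expr0 mul1r.
have /andP[x0 x1] := p01 0; have /andP[y0 y1] := p01 k.
have /andP[z0 z1] := p01 k.+1.
have Q0 : 0 <= q ^+ k.+1 by exact: exprn_ge0.
have stepk := step k.
(* If [p k = 0] then [p 0 = 0], and if [p k = 1] then [p k.+1 = 1]; either way the left side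
   vanishes. *)
have [y_0|y_gt0] := leP (p k) 0.
  have py : p k = 0 by apply/eqP; rewrite eq_le y_0.
  move: IHk; rewrite py mul0r mulr0 subr0 mulr1 => x_0.
  have -> : p 0 = 0 by apply/eqP; rewrite eq_le x_0.
  by rewrite mul0r !mulr_ge0// subr0.
have [y_1|y_lt1] := leP 1 (p k).
  have py : p k = 1 by apply/eqP; rewrite eq_le y1.
  move: stepk; rewrite py mul1r subrr !mulr0 => z_1.
  have -> : p k.+1 = 1 by lra.
  by rewrite subrr mulr0 mul1r mulr_ge0// subr_ge0.
(* The product of the induction hypothesis and the step has this common factor on both sides, and it
   cancels. *)
have yy : 0 < p k * (1 - p k) by rewrite mulr_gt0// subr_gt0.
rewrite -(ler_pM2l yy).
have l1 : 0 <= p 0 * (1 - p k) by rewrite mulr_ge0// subr_ge0.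
have l2 : 0 <= p k * (1 - p k.+1) by rewrite mulr_ge0// subr_ge0.
have := ler_pM l1 l2 IHk stepk; rewrite exprSr; lra.
Qed.

(** * Radii of probability one half *)

Section thresholds.
Context {R : realType} (M : metricProbSpace R).

(** The intermediate value theorem between 0 and a radius of probability 1; the radius found is
    positive because the probability at 0 is 0. *)
Lemma median_radius (n : nat) (F : graph_property n) : regular M ->
  (1 <= n)%N -> nontrivial_property F -> monotone_property F ->
  exists2 r, 0 < r & fine (prob_rgg M F r) = 2^-1.
Proof.
move=> reg n1 ntF mF; have [cont p0 [r0 p1]] := reg n F n1 ntF mF.
pose b := Num.max 0 r0.
have pb : fine (prob_rgg M F b) = 1 by rewrite p1 ?le_max ?lexx ?orbT.
have b0 : 0 <= b by rewrite le_max lexx.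
have contb : {within `[0, b], continuous (fine \o prob_rgg M F)}.
  have : {within `[0, b], continuous (prob_rgg M F)}.
    apply: continuous_subspaceW cont => x /=.
    by rewrite !in_itv/= => /andP[->].
  move=> + x => /(_ x) cx; apply: fine_cvg.
  by rewrite fineK ?prob_rgg_fin_num.
have [|r] := @IVT R (fine \o prob_rgg M F) 0 b 2^-1 b0 contb.
  by rewrite /= p0 pb/= ge_min le_max invr_ge0 ler0n/= invf_le1 ?ler1n ?orbT.
rewrite in_itv/= => /andP[r_ge0 _] pr; exists r => //.
rewrite lt_neqAle r_ge0 andbT; apply/eqP => r_0.
by move: pr; rewrite -r_0 p0/= => /eqP; rewrite eq_sym invr_eq0 pnatr_eq0.
Qed.

(** * Iteration of the expansion step *)

Section expansion_iteration.
Variables (K rho : R).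
Hypothesis K1 : 1 <= K.
Hypothesis rho01 : 0 < rho <= 1.
Hypothesis expand : has_expansion M K rho.

(** Follows the odds along the radii [K ^+ i * r], then compares [K ^+ k * r] with [s] by
    monotonicity. The remaining factor on the right is at most 1 and is dropped, which leaves a
    bound uniform in [n] and [F]. *)
Lemma prob_rgg_expand (n : nat) (F : graph_property n) (k : nat) (r s : R) :
  (1 <= n)%N -> monotone_property F -> 0 <= r -> K ^+ k * r <= s ->
  fine (prob_rgg M F r) * (1 - fine (prob_rgg M F s)) <= ((1 - rho) ^+ 2) ^+ k.
Proof.
move=> n1 mF r0 Krs; have /andP[rho0 rho1] := rho01.
have K0 : 0 <= K by exact: le_trans K1.
pose p i := fine (prob_rgg M F (K ^+ i * r)).
have p01 i : 0 <= p i <= 1 by rewrite fine_prob_rgg_ge0 fine_prob_rgg_le1.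
have step i : p i * (1 - p i.+1) <= (1 - rho) ^+ 2 * (p i.+1 * (1 - p i)).
  rewrite /p exprS -mulrA; apply: has_expansion_odds => //.
  by rewrite mulr_ge0// exprn_ge0.
have it := odds_iter (sqr_ge0 _) p01 step k.
have p_0 : p 0 = fine (prob_rgg M F r) by rewrite /p expr0 mul1r.
rewrite p_0 in it.
have pks : p k <= fine (prob_rgg M F s) by exact: le_fine_prob_rgg.
have /andP[pk0 pk1] := p01 k.
have pr0 := fine_prob_rgg_ge0 M F r; have pr1 := fine_prob_rgg_le1 M F r.
apply: (@le_trans _ _ (fine (prob_rgg M F r) * (1 - p k))).
  by rewrite ler_wpM2l// lerD2l lerN2.
apply: (le_trans it); rewrite ler_piMr//; first by rewrite !exprn_ge0 ?subr_ge0.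
by rewrite mulr_ile1// ?subr_ge0// gerBl.
Qed.

(** The factor 2 compensates the probability 1/2 at the median radius; the powers tend to 0 because
    [0 < rho <= 1]. *)
Lemma small_odds_factor (e : R) : 0 < e ->
  exists k, 2 * ((1 - rho) ^+ 2) ^+ k < e.
Proof.
move=> e0; have /andP[rho0 rho1] := rho01.
have q1 : `|(1 - rho) ^+ 2| < 1.
  by rewrite ger0_norm ?sqr_ge0// expr_lt1// ?subr_ge0// gtrBl.
have /cvgr0Pnorm_lt/(_ _ e0) [k _ /(_ k (leqnn k))] := cvg_geometric 2 q1.
by move=> /= /(le_lt_trans (ler_norm _)); exists k.
Qed.

End expansion_iteration.
End thresholds.

(** * Median radii as thresholds *)

Theorem theorem1p1 (R : realType) (M : metricProbSpace R) :
  regular M -> expands_uniformly M -> admits_thresholds M.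
Proof.
move=> reg [K0 [rho [K0_ge0 rho01 exp0]]] F ntF.
pose K := Num.max K0 1.
have K1 : 1 <= K by rewrite le_max lexx orbT.
have Kgt0 k : 0 < K ^+ k by rewrite exprn_gt0// (lt_le_trans ltr01).
have expand : has_expansion M K rho.
  by apply: has_expansion_le exp0; rewrite le_max lexx.
(* For [n < 2] the value 1 is a default: only positivity is required there, and limits ignore these
   indices. *)
have /choice[r hr] n : exists r : R,
    0 < r /\ ((2 <= n)%N -> fine (prob_rgg M (F n) r) = 2^-1).
  have [n2|n2] := boolP (2 <= n)%N; last by exists 1.
  have [ntFn mFn] := ntF n n2.
  by have [r r0 pr] := median_radius reg (ltnW n2) ntFn mFn; exists r.
exists r; split => [n|s s0 sr|s s0 sr]; first by have [] := hr n.
- apply/fine_cvgP; split; first by apply: nearW => n; exact: prob_rgg_fin_num.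
  apply/cvgr0Pnorm_lt => e e0; have [k ke] := small_odds_factor rho01 e0.
  (* The number of steps [k] depends on [e] alone. Eventually [r n] lies at least [k] factors of [K]
     above [s n], so half the probability at [s n] is at most [((1 - rho) ^+ 2) ^+ k]. *)
  have /cvgr0Pnorm_lt/(_ (K ^+ k)^-1) := sr.
  rewrite invr_gt0 => /(_ (Kgt0 k)) srk.
  near=> n.
  have n2 : (2 <= n)%N by near: n; exact: nbhs_infty_ge.
  have [r0 pr] := hr n; have [_ mFn] := ntF n n2.
  have sn : K ^+ k * s n <= r n.
    have : `|s n / r n| < (K ^+ k)^-1 by near: n.
    rewrite ger0_norm ?divr_ge0 ?(ltW r0)// ltr_pdivrMr// => /ltW.
    by rewrite mulrC ler_pdivlMr// mulrC.
  have := prob_rgg_expand K1 rho01 expand (ltnW n2) mFn (s0 n) sn.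
  have p0 := fine_prob_rgg_ge0 M (F n) (s n).
  by rewrite pr//= ger0_norm//; lra.
- apply/fine_cvgP; split; first by apply: nearW => n; exact: prob_rgg_fin_num.
  apply/cvgrPdist_lt => e e0; have [k ke] := small_odds_factor rho01 e0.
  (* Symmetrically, [s n] is eventually at least [k] factors of [K] above [r n], and half the
     complementary probability at [s n] obeys the same bound. *)
  have /cvgryPge/(_ (K ^+ k)) srk := sr.
  near=> n.
  have n2 : (2 <= n)%N by near: n; exact: nbhs_infty_ge.
  have [r0 pr] := hr n; have [_ mFn] := ntF n n2.
  have sn : K ^+ k * r n <= s n.
    by rewrite -ler_pdivlMr//; near: n.
  have := prob_rgg_expand K1 rho01 expand (ltnW n2) mFn (ltW r0) sn.
  have p1 := fine_prob_rgg_le1 M (F n) (s n).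
  by rewrite pr//= ger0_norm ?subr_ge0//; lra.
Unshelve. all: by end_near.
Qed.
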